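(* Let $\Bbbk$ be a field of characteristic zero, $t\in\Bbbk$ and $n\in\mathbb N\cup\{\infty\}$. For all $\beta,\delta\in\Lambda(n)_t$, the set $\{\xi_q \mid q\in\mathcal{M}at_n(\delta,\beta)_t\}$ is a $\Bbbk$-basis of $\operatorname{Hom}_{\operatorname{Perm}(\mathfrak S_\infty;\mu_t)}(\mathcal X^\beta,\mathcal X^\delta)$, and each such summand of $\mathbb S(n,t)=\bigoplus_{\beta,\delta\in\Lambda(n)_t}\operatorname{Hom}_{\operatorname{Perm}(\mathfrak S_\infty;\mu_t)}(\mathcal X^\beta,\mathcal X^\delta)$ is finite-dimensional over $\Bbbk$. Moreover, $\{\xi_q\mid q\in\mathcal{M}at_n(t)\}$ is a $\Bbbk$-basis of $\mathbb S(n,t)$.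
   Context: Combinatorics. $\mathbb N=\{1,2,\dots\}$ and $[1,n]=\{1,\dots,n\}$ ($[1,\infty]=\mathbb N$). $\Lambda(n)_t$ is the set of sequences $\beta=(\beta_i)_{i\in[1,n]}$ with $\beta_1\in t-\mathbb Z=\{t-m\mid m\in\mathbb Z\}$, $\beta_i\in\mathbb Z_{\ge 0}$ for $i\ge 2$ (all but finitely many equal to $0$), and $\sum_i\beta_i=t$. For $\beta,\delta\in\Lambda(n)_t$, $\mathcal{M}at_n(\delta,\beta)_t$ is the set of matrices $q=(q_{i,j})_{i,j\in[1,n]}$ with $q_{1,1}\in t-\mathbb Z$, all other $q_{i,j}\in\mathbb Z_{\ge0}$, $\sum_{i,j}q_{i,j}=t$, column sums $\sum_i q_{i,j}=\beta_j$ and row sums $\sum_j q_{i,j}=\delta_i$. $\mathcal{M}at_n(t)$ is the union of these sets over all $\beta,\delta\in\Lambda(n)_t$. The category. $\mathfrak S_\infty$ is the group of all bijections of $\Omega=\mathbb N$, with the topology in which the pointwise stabilizers of finite subsets of $\Omega$ form a base of open neighborhoods of the identity. An action of an open subgroup $U$ on a set is smooth if all point stabilizers are open. A finitary $\widehat{\mathfrak S}_\infty$-set is a set with a smooth action of some open subgroup $U\subseteq\mathfrak S_\infty$ having finitely many orbits (one may shrink $U$); a finitary $\mathfrak S_\infty$-set is a smooth $\mathfrak S_\infty$-set with finitely many orbits. Let $\mathfrak S(p)$ be the pointwise stabilizer of $\{1,\dots,p\}$. For a finitary $\widehat{\mathfrak S}_\infty$-set $X$ there is a unique polynomial $p_X\in\mathbb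 Q[T]$ with $p_X(p)=|X^{\mathfrak S(p)}|$ for all sufficiently large integers $p$; set $\mu_t(X)=p_X(t)$. If $f:X\to\Bbbk$ is constant on the orbits of such an open subgroup, put $\int_X f(x)\,dx=\sum_c c\,\mu_t(f^{-1}(c))$, the sum being over the finitely many values $c$ of $f$. The category $\operatorname{Perm}(\mathfrak S_\infty;\mu_t)$ has as objects the finitary $\mathfrak S_\infty$-sets; $\operatorname{Hom}(X,Y)$ is the space of functions $Y\times X\to\Bbbk$ constant on the diagonal $\mathfrak S_\infty$-orbits; composition is $(g\circ f)(z,x)=\int_Y g(z,y)f(y,x)\,dy$. The algebra. For $\beta\in\Lambda(n)_t$ and $k\ge2$ let $\{\beta\}_k=[1+\sum_{i=2}^{k-1}\beta_i,\ \sum_{i=2}^{k}\beta_i]\subset\Omega$ (an interval of $\beta_k$ integers), and $\{\beta\}_1=\Omega\setminus\bigcup_{k\ge2}\{\beta\}_k$. $\mathfrak S_\beta\le\mathfrak S_\infty$ is the subgroup preserving each $\{\beta\}_k$, and $\mathcal X^\beta=\mathfrak S_\infty/\mathfrak S_\beta$. $\mathbb S(n,t)$ is the direct sum displayed in the claim, with product given by composition (zero if not composable). For $q\in\mathcal{M}at_n(\delta,\beta)_t$, $\xi_q\in\operatorname{Hom}(\mathcal X^\beta,\mathcal X^\delta)$ is the indicator function of the $\mathfrak S_\infty$-orbit of $(\mathfrak S_\delta,\sigma\mathfrak S_\beta)$ in $\mathcal X^\delta\times\mathcal X^\beta$, where $\sigma\in\mathfrak S_\infty$ is any element with $|\{\delta\}_i\cap\sigma(\{\beta\}_j)|=q_{i,j}$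 for all $(i,j)\ne(1,1)$. *)

(* Defs.v *)
From HB Require Import structures.
From mathcomp Require Import all_boot all_order all_algebra.
From mathcomp Require Import boolp classical_sets functions cardinality fsbigop.
From mathcomp Require Import topology.

Set Implicit Arguments.
Unset Strict Implicit.
Unset Printing Implicit Defensive.

Import Order.TTheory GRing.Theory Num.Theory.

Local Open Scope classical_set_scope.
Local Open Scope ring_scope.

(* The interval [1, n] of the positive integers, where n = None stands for
   infinity. *)
Definition seg (n : option nat) : Type :=
  {i : nat | (0 < i)%N && (if n is Some m then (i <= m)%N else true)}.

HB.instance Definition _ n := Countable.on (seg n).

Definition seg_nat n (i : seg n) : nat := sval i.
Coercion seg_nat : seg >-> nat.

Notation Omega := (seg None).

Definition Sinf : Type := {f : Omega -> Omega | `[< bijective f >]}.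

HB.instance Definition _ := Choice.on Sinf.

Definition Sinf_fun (s : Sinf) : Omega -> Omega := sval s.
Coercion Sinf_fun : Sinf >-> Funclass.

Lemma Sinf_ext (s u : Sinf) : s =1 u -> s = u.
Proof. by move=> su; apply/val_inj/funext. Qed.

Lemma Sinf_bij (s : Sinf) : bijective s.
Proof. exact/asboolP/(valP s). Qed.

Definition Sinf_one : Sinf :=
  exist _ id (introT (asboolP _) (Bijective (fun=> erefl) (fun=> erefl))).

Definition Sinf_mul (s u : Sinf) : Sinf :=
  exist _ (s \o u) (introT (asboolP _) (bij_comp (Sinf_bij s) (Sinf_bij u))).

Lemma Sinf_inv_subproof (s : Sinf) : exists u : Sinf, cancel u s /\ cancel s u.
Proof.
have [g gK Kg] := Sinf_bij s.
by exists (exist _ g (introT (asboolP _) (Bijective Kg gK))).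
Qed.

Definition Sinf_inv (s : Sinf) : Sinf := sval (cid (Sinf_inv_subproof s)).

Lemma Sinf_invK (s : Sinf) : cancel (Sinf_inv s) s /\ cancel s (Sinf_inv s).
Proof. exact: (svalP (cid (Sinf_inv_subproof s))). Qed.

Fact Sinf_mulA : associative Sinf_mul.
Proof. by move=> s u v; apply: Sinf_ext. Qed.
Fact Sinf_mul1 : left_id Sinf_one Sinf_mul.
Proof. by move=> s; apply: Sinf_ext. Qed.
Fact Sinf_1mul : right_id Sinf_one Sinf_mul.
Proof. by move=> s; apply: Sinf_ext. Qed.
Fact Sinf_mulV : left_inverse Sinf_one Sinf_inv Sinf_mul.
Proof. by move=> s; apply: Sinf_ext => x; apply: (Sinf_invK s).2. Qed.
Fact Sinf_Vmul : right_inverse Sinf_one Sinf_inv Sinf_mul.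
Proof. by move=> s; apply: Sinf_ext => x; apply: (Sinf_invK s).1. Qed.

HB.instance Definition _ := isGroup.Build Sinf
  Sinf_mulA Sinf_mul1 Sinf_1mul Sinf_mulV Sinf_Vmul.

Lemma Sinf_mulE (s u : Sinf) x : Sinf_fun (s * u)%g x = s (u x).
Proof. by []. Qed.
Lemma Sinf_oneE x : Sinf_fun 1%g x = x.
Proof. by []. Qed.
Lemma Sinf_KV (s : Sinf) : cancel s (Sinf_fun s^-1%g).
Proof. exact: (Sinf_invK s).2. Qed.
Lemma Sinf_VK (s : Sinf) : cancel (Sinf_fun s^-1%g) s.
Proof. exact: (Sinf_invK s).1. Qed.
Lemma Sinf_inj (s : Sinf) : injective s.
Proof. exact: can_inj (Sinf_KV s). Qed.

Definition Sfix (F : set Omega) : set Sinf :=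
  [set s | forall x, F x -> s x = x].

Definition Sinf_op (U : set Sinf) : Prop :=
  forall s, U s -> exists2 F, finite_set F & forall u, Sfix F u -> U (s * u)%g.

Fact Sinf_opT : Sinf_op setT.
Proof. by move=> s _; exists set0. Qed.

Fact Sinf_opI : setI_closed Sinf_op.
Proof.
move=> U V oU oV s [/oU[F finF FU] /oV[G finG GV]].
exists (F `|` G); first by rewrite finite_setU.
move=> u uFG; split; [apply: FU | apply: GV] => x Fx; apply: uFG.
  by left.
by right.
Qed.

Fact Sinf_op_bigU (I : Type) (f : I -> set Sinf) :
  (forall i, Sinf_op (f i)) -> Sinf_op (\bigcup_i f i).
Proof.
move=> of_ s [i _ /of_[F finF FU]]; exists F => // u /FU fu.
by exists i.
Qed.

HB.instance Definition _ := isOpenTopological.Build Sinf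
  Sinf_opT Sinf_opI Sinf_op_bigU.

Lemma Sinf_openE (U : set Sinf) : open U = Sinf_op U.
Proof. by []. Qed.

(* Finitary S_oo-sets *)
Record permset := PermSet {
  pset :> Type;
  pact : Sinf -> pset -> pset;
  pact1 : forall x, pact 1%g x = x;
  pactM : forall s u x, pact (s * u)%g x = pact s (pact u x);
  pact_smooth : forall x, open [set s | pact s x = x];
  pact_finorb : finite_set (range (fun x => range (pact^~ x)))
}.

Lemma pactK (X : permset) s : cancel (@pact X s) (pact s^-1%g).
Proof. by move=> x; rewrite -pactM mulVg pact1. Qed.

Lemma pactVK (X : permset) s : cancel (pact s^-1%g) (@pact X s).
Proof. by move=> x; rewrite -pactM mulgV pact1. Qed.

(* S(p) is the pointwise stabilizer of {1, ..., p}. *)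
Definition Sstab (p : nat) : set Sinf := Sfix [set x : Omega | (x <= p)%N].

Lemma open_Sstab (U : set Sinf) :
  open U -> U 1%g -> exists m, Sstab m `<=` U.
Proof.
rewrite Sinf_openE => oU /oU[F finF FU].
have [m Fm] : exists m, forall x : Omega, F x -> (x <= m)%N.
  have /finite_seqP[A FA] := finF; exists (\max_(x <- A) (x : Omega))%N => x.
  by rewrite FA /= => xA; apply: leq_bigmax_seq.
exists m => u um; rewrite -[u]mul1g; apply: FU => x /Fm; exact: um.
Qed.

Section measure.
Variable k : fieldType.
Implicit Types (t : k) (X Y Z : permset).

(* The finitary sets whose measure is taken are subsets A of a finitary
   S_oo-set X which are stable under some open subgroup U; for S(p) contained
   in U, fixed_pts A p is then the set of S(p)-fixed points of the U-set A. *)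
Definition fixed_pts X (A : set X) (p : nat) : set X :=
  [set x | A x /\ forall s, Sstab p s -> pact s x = x].

Definition is_count_poly X (A : set X) (P : {poly rat}) : Prop :=
  exists N, forall p, (N <= p)%N ->
    exists2 m, (fixed_pts A p #= `I_m)%card & P.[p%:R] = m%:R.

(* The polynomial p_A, when it exists, is unique: it is prescribed at all large
   integers. *)
Definition mu t X (A : set X) : k :=
  (map_poly ratr (xget 0 [set P | is_count_poly A P])).[t].

(* The sum is finite when f is constant on the orbits of an open subgroup. *)
Definition integral t X (f : X -> k) : k :=
  \sum_(c \in range f) c * mu t (f @^-1` [set c]).

Definition Sstable X (A : set X) : Prop :=
  exists m, forall s x, Sstab m s -> A x -> A (pact s x).

Lemma transp_subproof (a b : Omega) : exists s : Sinf,
  [/\ s a = b & forall x, x != a -> x != b -> s x = x].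
Proof.
pose f x := if x == a then b else if x == b then a else x.
have fK : involutive f.
  move=> x; rewrite /f; have [->|xa] := eqVneq x a.
    by rewrite eqxx; case: eqVneq.
  by have [->|xb] := eqVneq x b; rewrite ?eqxx // (negPf xa) (negPf xb).
exists (exist _ f (introT (asboolP _) (inv_bij fK))).
by split=> [|x /negPf xa /negPf xb]; rewrite /Sinf_fun /= /f ?eqxx // xa xb.
Qed.

Lemma finitary_ext (s : Sinf) m : exists r : Sinf,
  (forall x : Omega, (x <= m)%N -> r x = s x) /\
  exists M, forall x : Omega, (M < x)%N -> r x = x.
Proof.
elim: m => [|m [r [rs [M rM]]]].
  exists 1%g; split; last by exists 0%N.
  by move=> x x0; have := valP x; rewrite /= andbT ltnNge [(_ <= _)%N]x0.
have a0 : (0 < m.+1)%N && true by [].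
pose a : Omega := exist _ m.+1 a0.
have [u [ua uE]] := transp_subproof (r a) (s a).
exists (u * r)%g; split.
  move=> x xm; rewrite Sinf_mulE; have [->//|xa] := eqVneq x a.
  have {}xm : (x <= m)%N.
    move: xm; rewrite leq_eqVlt => /orP[/eqP xm|//].
    by case/eqP: xa; apply: val_inj.
  have ra : r x != r a by rewrite (inj_eq (@Sinf_inj r)).
  have sa : r x != s a by rewrite rs // (inj_eq (@Sinf_inj s)).
  by rewrite uE // rs.
exists (maxn M (maxn (r a) (s a))) => x; rewrite !gtn_max => /and3P[xM xr xs].
rewrite Sinf_mulE rM // uE //.
  by apply: contraTneq xr => ->; rewrite ltnn.
by apply: contraTneq xs => ->; rewrite ltnn.
Qed.

Lemma Sstab_inv m s : Sstab m s -> Sstab m s^-1%g.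
Proof. by move=> sm x xm; rewrite -{1}[x](sm x xm) Sinf_KV. Qed.

Lemma fixed_pts_act X (A : set X) (r : Sinf) M p :
  (forall x : Omega, (M < x)%N -> r x = x) -> (M <= p)%N ->
  fixed_pts (pact r @` A) p = pact r @` fixed_pts A p.
Proof.
move=> rM Mp.
have rp (x : Omega) : (x <= p)%N -> (r x <= p)%N.
  move=> xp; rewrite leqNgt; apply: contraL xp => prx; rewrite -ltnNge.
  have /Sinf_inj rxx : r (r x) = r x by apply: rM; apply: leq_ltn_trans prx.
  by rewrite -rxx.
have rVp (x : Omega) : (x <= p)%N -> (Sinf_fun r^-1%g x <= p)%N.
  move=> xp; rewrite leqNgt; apply: contraL xp => prx; rewrite -ltnNge.
  have : r (Sinf_fun r^-1%g x) = Sinf_fun r^-1%g x.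
    by apply: rM; apply: leq_ltn_trans prx.
  by rewrite Sinf_VK => ->.
apply/seteqP; split => [_ [[x Ax <-] xs]|_ [x [Ax xs] <-]].
  exists x => //; split=> // s sp.
  have /xs : Sstab p (r * s * r^-1)%g.
    by move=> y yp; rewrite !Sinf_mulE sp ?Sinf_VK //; apply: rVp.
  by rewrite !pactM pactK => /(can_inj (pactK r)).
split; first by exists x.
move=> s sp; have /xs : Sstab p (r^-1 * s * r)%g.
  by move=> y yp; rewrite !Sinf_mulE sp ?Sinf_KV //; apply: rp.
by rewrite !pactM => {2}<-; rewrite pactVK.
Qed.

Lemma mu_act t X (A : set X) s : Sstable A -> mu t (pact s @` A) = mu t A.
Proof.
move=> [m Am]; have [r [rs [M rM]]] := finitary_ext s m.
have rsm : Sstab m (r^-1 * s)%g.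
  by move=> x xm; rewrite Sinf_mulE -rs // Sinf_KV.
have -> : pact s @` A = pact r @` A.
  apply/seteqP; split => _ [x Ax <-].
    exists (pact (r^-1 * s)%g x); first exact: Am.
    by rewrite -pactM mulgA mulgV mul1g.
  exists (pact (s^-1 * r)%g x); last by rewrite -pactM mulgA mulgV mul1g.
  by apply: Am => //; have := Sstab_inv rsm; rewrite invgM invgK.
rewrite /mu; congr (map_poly _ (xget _ _)).[_]; apply/seteqP.
have cardE p : (M <= p)%N -> forall m,
    (fixed_pts (pact r @` A) p #= `I_m)%card = (fixed_pts A p #= `I_m)%card.
  move=> Mp q; rewrite (fixed_pts_act _ rM) //.
  by apply/card_eql/inj_card_eq; apply: in2W; exact: can_inj (pactK r).
by split => P [N NP]; exists (maxn N M) => p; rewrite geq_max => /andP[Np Mp];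
   have [q qI qP] := NP p Np; exists q; rewrite ?cardE // -?cardE.
Qed.

Lemma integral_act t X (f : X -> k) s :
  (exists m, forall u x, Sstab m u -> f (pact u x) = f x) ->
  integral t (f \o pact s) = integral t f.
Proof.
move=> [m fm]; rewrite /integral; have -> : range (f \o pact s) = range f.
  apply/seteqP; split => _ [x _ <-]; first by exists (pact s x).
  by exists (pact s^-1%g x) => //=; rewrite pactVK.
apply: eq_fsbigr => c _; congr (_ * _).
rewrite -[in RHS](@mu_act t X _ s^-1%g); last first.
  by exists m => u x um /= <-; apply: fm.
congr (mu t _); apply/seteqP; split => [x /= fx|_ [x fx <-]] /=.
  by exists (pact s x) => //; rewrite pactK.
by rewrite pactVK.
Qed.

Definition orbit_constant X Y (f : Y * X -> k^o) : Prop :=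
  forall s y x, f (pact s y, pact s x) = f (y, x).

Definition orbit_const_pred X Y : {pred (Y * X -> k^o)} :=
  fun f => `[< @orbit_constant X Y f >].

Fact orbit_const_submod X Y : submod_closed (@orbit_const_pred X Y).
Proof.
split; first exact/asboolP.
move=> a f g /asboolP fP /asboolP gP; apply/asboolP => s y x.
by rewrite /= /GRing.add /GRing.scale /= fP gP.
Qed.

HB.instance Definition _ X Y := GRing.isSubmodClosed.Build k (Y * X -> k^o)
  (@orbit_const_pred X Y) (@orbit_const_submod X Y).

Record perm_hom X Y : Type := PermHom {
  perm_hom_fun :> Y * X -> k^o;
  _ : perm_hom_fun \in @orbit_const_pred X Y
}.

HB.instance Definition _ X Y := [isSub for @perm_hom_fun X Y].
HB.instance Definition _ X Y := [Choice of perm_hom X Y by <:].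
HB.instance Definition _ X Y :=
  [SubChoice_isSubLmodule of perm_hom X Y by <:].

Lemma perm_homP X Y (f : perm_hom X Y) : @orbit_constant X Y f.
Proof. exact/asboolP/(valP f). Qed.

Lemma perm_comp_subproof t X Y Z (g : perm_hom Y Z) (f : perm_hom X Y) :
  (fun p => integral t (fun y => g (p.1, y) * f (y, p.2)))
    \in @orbit_const_pred X Z.
Proof.
apply/asboolP => s z x /=.
rewrite -[RHS](@integral_act _ _ _ s^-1%g).
  congr (integral t _); apply/funext => y /=.
  by rewrite -[in LHS](pactVK s y) !perm_homP.
have [||m mU] :=
    @open_Sstab ([set u | pact u z = z] `&` [set u | pact u x = x]).
- by apply: openI; apply: pact_smooth.
- by split; apply: pact1.
by exists m => u y /mU[/= uz ux]; rewrite -{1}uz -{1}ux !perm_homP.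
Qed.

Definition perm_comp t X Y Z (g : perm_hom Y Z) (f : perm_hom X Y) :
    perm_hom X Z :=
  PermHom (perm_comp_subproof t g f).

Lemma perm_comp0l t X Y Z (f : perm_hom X Y) :
  perm_comp t (0 : perm_hom Y Z) f = 0.
Proof.
apply/val_inj/funext => p; apply: fsbig1 => _ [y _ <-].
by rewrite mul0r mul0r.
Qed.

Lemma perm_comp0r t X Y Z (g : perm_hom Y Z) :
  perm_comp t g (0 : perm_hom X Y) = 0.
Proof.
apply/val_inj/funext => p; apply: fsbig1 => _ [y _ <-].
by rewrite mulr0 mul0r.
Qed.

End measure.

(* The data of a k-linear category; the axioms of a category are not part of
   this structure. *)
Record lincat_data (k : fieldType) := LincatData {
  Obj : Type;
  Mor : Obj -> Obj -> lmodType k;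
  Mcomp : forall X Y Z, Mor Y Z -> Mor X Y -> Mor X Z
}.

Arguments Mor {k} _ X Y.
Arguments Mcomp {k} _ {X Y Z} g f.

Definition Perm (k : fieldType) (t : k) : lincat_data k :=
  @LincatData k permset (fun X Y => perm_hom k X Y) (perm_comp t).

Section direct_sum.
Variables (k : fieldType) (J : choiceType) (V : J -> lmodType k).

Definition dprod : Type := forall j, V j.

HB.instance Definition _ := Choice.on dprod.

Let dadd (f g : dprod) : dprod := fun j => f j + g j.
Let dopp (f : dprod) : dprod := fun j => - f j.
Let dzero : dprod := fun j => 0.
Let dscale (a : k) (f : dprod) : dprod := fun j => a *: f j.

Let daddA : associative dadd.
Proof. by move=> f g h; apply: functional_extensionality_dep => j; apply: addrA. Qed.
Let daddC : commutative dadd.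
Proof. by move=> f g; apply: functional_extensionality_dep => j; apply: addrC. Qed.
Let dadd0 : left_id dzero dadd.
Proof. by move=> f; apply: functional_extensionality_dep => j; apply: add0r. Qed.
Let daddN : left_inverse dzero dopp dadd.
Proof. by move=> f; apply: functional_extensionality_dep => j; apply: addNr. Qed.

HB.instance Definition _ :=
  GRing.isZmodule.Build dprod daddA daddC dadd0 daddN.

Let dscaleA a b (f : dprod) : dscale a (dscale b f) = dscale (a * b) f.
Proof. by apply: functional_extensionality_dep => j; apply: scalerA. Qed.
Let dscale1 : left_id 1 dscale.
Proof. by move=> f; apply: functional_extensionality_dep => j; apply: scale1r. Qed.
Let dscaleDr : right_distributive dscale +%R.
Proof. by move=> a f g; apply: functional_extensionality_dep => j; apply: scalerDr. Qed.
Let dscaleDl (f : dprod) : {morph dscale^~ f : a b / a + b}.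
Proof. by move=> a b; apply: functional_extensionality_dep => j; apply: scalerDl. Qed.

HB.instance Definition _ :=
  GRing.Zmodule_isLmodule.Build k dprod dscaleA dscale1 dscaleDr dscaleDl.

Definition finsupp_pred : {pred dprod} :=
  fun f => `[< finite_set [set j | f j != 0] >].

Fact finsupp_submod : submod_closed finsupp_pred.
Proof.
split.
  apply/asboolP; suff -> : [set j | (0 : dprod) j != 0] = set0 by [].
  by apply/seteqP; split => // j /=; rewrite eqxx.
move=> a f g /asboolP ff /asboolP fg; apply/asboolP.
apply: (@sub_finite_set _ _ ([set j | f j != 0] `|` [set j | g j != 0])).
  move=> j /= fgj; apply/or_asboolP; move: fgj; apply: contraNT.
  rewrite negb_or => /andP[/asboolPn/negP + /asboolPn/negP].
  rewrite !negbK => /eqP fj /eqP gj.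
  by rewrite /GRing.add /GRing.scale /= /dadd /dscale fj gj scaler0 addr0.
by rewrite finite_setU.
Qed.

HB.instance Definition _ :=
  GRing.isSubmodClosed.Build k dprod finsupp_pred finsupp_submod.

Record dsum : Type := Dsum {
  dsum_fun :> dprod;
  _ : dsum_fun \in finsupp_pred
}.

HB.instance Definition _ := [isSub for dsum_fun].
HB.instance Definition _ := [Choice of dsum by <:].
HB.instance Definition _ := [SubChoice_isSubLmodule of dsum by <:].

Definition dinj_fun (j : J) (x : V j) : dprod :=
  fun i => if eqVneq j i is EqNotNeq e then ecast i (V i) e x else 0.

Lemma dinj_subproof j (x : V j) : dinj_fun x \in finsupp_pred.
Proof.
apply/asboolP; apply: (@sub_finite_set _ _ [set j]) => // i.
by rewrite /dinj_fun /=; case: eqVneq => //; rewrite eqxx.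
Qed.

Definition dinj j (x : V j) : dsum := Dsum (dinj_subproof x).

End direct_sum.

Section basis.
Variables (k : fieldType) (V : lmodType k).

Definition is_basis (I : choiceType) (v : I -> V) : Prop :=
  (forall c : I -> k, finite_set [set i | c i != 0] ->
     \sum_(i \in [set: I]) c i *: v i = 0 -> forall i, c i = 0) /\
  (forall x : V, exists2 c : I -> k, finite_set [set i | c i != 0] &
     x = \sum_(i \in [set: I]) c i *: v i).

Definition finite_dimensional : Prop :=
  exists (d : nat) (v : 'I_d -> V), is_basis v.

End basis.

Section combinatorics.
Variables (k : fieldType) (t : k) (n : option nat).

Definition in_shift (x : k) : Prop := exists m : int, x = t - m%:~R.
Definition is_nat (x : k) : Prop := exists m : nat, x = m%:R.

(* The natural number equal to x; it is unique when k has characteristic zero,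
   and taking the least one makes natv 0 = 0 in all characteristics. *)
Definition natv (x : k) : nat :=
  if pselect (exists m : nat, x == m%:R) is left e then ex_minn e else 0%N.

Definition Lambda_pred (b : seg n -> k) : Prop :=
  [/\ forall i : seg n, if i == 1%N :> nat then in_shift (b i) else is_nat (b i),
      finite_set [set i | b i != 0]
    & \sum_(i \in [set: seg n]) b i = t].

Definition Lambda : Type := {b : seg n -> k | `[< Lambda_pred b >]}.

HB.instance Definition _ := Choice.on Lambda.

Definition Lambda_fun (b : Lambda) : seg n -> k := sval b.
Coercion Lambda_fun : Lambda >-> Funclass.

(* d prescribes the row sums and b the column sums. *)
Definition Mat_pred (d b : Lambda) (q : seg n -> seg n -> k) : Prop :=
  [/\ (forall i j : seg n, if (i == 1%N :> nat) && (j == 1%N :> nat)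
                           then in_shift (q i j) else is_nat (q i j)),
      finite_set [set ij | q ij.1 ij.2 != 0],
      \sum_(ij \in [set: seg n * seg n]) q ij.1 ij.2 = t,
      (forall j, \sum_(i \in [set: seg n]) q i j = b j)
    & forall i, \sum_(j \in [set: seg n]) q i j = d i].

Definition Mat (d b : Lambda) : Type :=
  {q : seg n -> seg n -> k | `[< Mat_pred d b q >]}.

HB.instance Definition _ d b := Choice.on (Mat d b).

Definition Mat_fun d b (q : Mat d b) : seg n -> seg n -> k := sval q.
Coercion Mat_fun : Mat >-> Funclass.

Definition Mats : Type :=
  {q : seg n -> seg n -> k | `[< exists d b, Mat_pred d b q >]}.

HB.instance Definition _ := Choice.on Mats.

Lemma Mats_col_subproof (q : Mats) :
  `[< Lambda_pred (fun j => \sum_(i \in [set: seg n]) sval q i j) >].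
Proof.
have /asboolP[d [b [_ _ _ qb _]]] := valP q.
by rewrite (_ : (fun j => _) = b); [exact: (valP b)|exact/funext].
Qed.

Lemma Mats_row_subproof (q : Mats) :
  `[< Lambda_pred (fun i => \sum_(j \in [set: seg n]) sval q i j) >].
Proof.
have /asboolP[d [b [_ _ _ _ qd]]] := valP q.
by rewrite (_ : (fun i => _) = d); [exact: (valP d)|exact/funext].
Qed.

(* A matrix of Mats belongs to exactly one Mat d b, recovered from its sums. *)
Definition col_sums (q : Mats) : Lambda :=
  exist (fun b => is_true `[< Lambda_pred b >]) _ (Mats_col_subproof q).
Definition row_sums (q : Mats) : Lambda :=
  exist (fun b => is_true `[< Lambda_pred b >]) _ (Mats_row_subproof q).

Lemma Mats_Mat_subproof (q : Mats) :
  `[< Mat_pred (row_sums q) (col_sums q) (sval q) >].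
Proof. by have /asboolP[d [b [q1 q2 q3 _ _]]] := valP q; apply/asboolP. Qed.

Definition Mats_Mat (q : Mats) : Mat (row_sums q) (col_sums q) :=
  exist (fun r => is_true `[< Mat_pred _ _ r >]) _ (Mats_Mat_subproof q).

(* b_2 + ... + b_j *)
Definition psum (b : Lambda) (j : nat) : nat :=
  \big[addn/0%N]_(i \in [set i : seg n | (2 <= i <= j)%N]) natv (b i).

Definition interval (b : Lambda) (j : seg n) : set Omega :=
  [set x | (1 + psum b j.-1 <= x <= psum b j)%N].

Definition block (b : Lambda) (j : seg n) : set Omega :=
  if j == 1%N :> nat
  then ~` \bigcup_(i in [set i : seg n | (2 <= i)%N]) interval b i
  else interval b j.

Definition Sblock (b : Lambda) : set Sinf :=
  [set s | forall j, s @` block b j = block b j].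

Definition lcoset (H : set Sinf) (s : Sinf) : set Sinf :=
  [set (s * u)%g | u in H].

Definition Xset (b : Lambda) : Type :=
  {C : set Sinf | `[< exists s, C = lcoset (Sblock b) s >]}.

Definition Xpt (b : Lambda) (s : Sinf) : Xset b :=
  exist (fun C => is_true `[< exists s, C = lcoset (Sblock b) s >]) (lcoset (Sblock b) s) (introT (asboolP _) (ex_intro _ s erefl)).

Lemma XsetP b (C : Xset b) : exists s, C = Xpt b s.
Proof. by have /asboolP[s Cs] := valP C; exists s; apply/val_inj. Qed.

Lemma Xact_subproof b s (C : Xset b) :
  `[< exists u, [set (s * v)%g | v in sval C] = lcoset (Sblock b) u >].
Proof.
apply/asboolP; have [u ->] := XsetP C; exists (s * u)%g.
by rewrite /lcoset /= image_comp; under eq_imagel do rewrite /= mulgA.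
Qed.

Definition Xact b (s : Sinf) (C : Xset b) : Xset b :=
  exist (fun D => is_true `[< exists u, D = lcoset (Sblock b) u >])
    _ (Xact_subproof s C).

Lemma XactE b s u : Xact s (Xpt b u) = Xpt b (s * u)%g.
Proof.
apply/val_inj; rewrite /= /lcoset image_comp.
by under eq_imagel do rewrite /= mulgA.
Qed.

Lemma Sblock_fix b : exists2 F, finite_set F & Sfix F `<=` Sblock b.
Proof.
set F := \bigcup_(i in [set i : seg n | (2 <= i)%N]) interval b i.
exists F.
  have /asboolP[_ finb _] := valP b.
  apply: (@sub_finite_set _ _
    (\bigcup_(i in [set i : seg n | b i != 0]) interval b i)).
    move=> x [i i2 xi]; exists i => //=; apply/eqP => bi0.
    have natv0 : natv 0 = 0%N.
      rewrite /natv; case: pselect => // e; case: ex_minnP => m _ /(_ 0%N).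
      by rewrite eqxx leqn0 => /(_ isT)/eqP.
    move: xi; rewrite /interval /= (_ : psum b i = psum b i.-1).
      by case/andP => xl /(leq_trans xl); rewrite add1n ltnn.
    apply/esym/fsbig_widen => j /= => [/andP[-> ji]|[/andP[j2 ji] jn]].
      by rewrite (leq_trans ji) // leq_pred.
    rewrite (_ : j = i) ?bi0 //; apply/val_inj/eqP.
    rewrite /= eqn_leq ji /=; move/negP: jn; rewrite j2 /= -ltnNge.
    by rewrite prednK // (leq_trans _ i2).
  apply: bigcup_finite => // i _.
  apply: (@sub_finite_set _ _ (@seg_nat None @^-1` `I_(psum b i).+1)).
    by move=> x /andP[_].
  by apply: finite_preimage => //; apply: in2W => x y; exact: val_inj.
move=> s sF j; rewrite /block -/F.
have sub (A : set Omega) : A `<=` F -> s @` A = A.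
  move=> AF; apply/seteqP; split => [_ [x Ax <-]|x Ax].
    by rewrite sF //; apply: AF.
  by exists x => //; apply: sF; apply: AF.
case: ifPn => [_|j1].
  apply/seteqP; split => [_ [x Fx <-] Fsx|x Fx].
    by apply: Fx; rewrite -(Sinf_inj (sF _ Fsx)).
  exists (Sinf_fun s^-1%g x); last by rewrite Sinf_VK.
  by move=> Fs; apply: Fx; rewrite -[x](Sinf_VK s) sF.
apply: sub => x xj; exists j => //=.
by rewrite ltn_neqAle eq_sym j1; case/andP: (valP j).
Qed.

Lemma Xpt_mulr b s u : Sblock b u -> Xpt b (s * u)%g = Xpt b s.
Proof.
move=> bu; apply/val_inj => /=; apply/seteqP; split => _ [v bv <-].
  exists (u * v)%g; last by rewrite mulgA.
  by move=> j; rewrite -[in RHS](bu j) -[in RHS](bv j) image_comp.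
exists (u^-1 * v)%g; last by rewrite -mulgA mulVKg.
move=> j; rewrite -[LHS](image_comp v (Sinf_fun u^-1%g)) bv -[in LHS](bu j).
by rewrite image_comp; under eq_imagel do rewrite /= Sinf_KV; rewrite image_id.
Qed.

Lemma Xact_smooth b (C : Xset b) : open [set s | Xact s C = C].
Proof.
have [u ->] := XsetP C; rewrite Sinf_openE => s /= sC.
have [F finF FB] := Sblock_fix b.
exists (u @` F); first exact: finite_image.
move=> v vF; rewrite -[RHS]sC !XactE -mulgA.
have -> : (s * (v * u) = s * u * (u^-1 * v * u))%g by rewrite !mulgA mulgK.
rewrite Xpt_mulr //; apply: FB => x Fx.
by rewrite !Sinf_mulE vF ?Sinf_KV //; exists x.
Qed.

Lemma Xact1 b (C : Xset b) : Xact 1%g C = C.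
Proof. by have [u ->] := XsetP C; rewrite XactE mul1g. Qed.

Lemma XactM b s u (C : Xset b) : Xact (s * u)%g C = Xact s (Xact u C).
Proof. by have [v ->] := XsetP C; rewrite !XactE mulgA. Qed.

Lemma Xact_finorb b : finite_set (range (fun C : Xset b => range (fun s => Xact s C))).
Proof.
apply: (@sub_finite_set _ _ [set setT]) => // _ [C _ <-].
apply/seteqP; split => // D _; have [[s ->] [u ->]] := (XsetP C, XsetP D).
by exists (u * s^-1)%g => //; rewrite XactE -mulgA mulVg mulg1.
Qed.

Definition Xperm (b : Lambda) : permset :=
  PermSet (@Xact1 b) (@XactM b) (@Xact_smooth b) (@Xact_finorb b).

Definition Xhom (b d : Lambda) : lmodType k :=
  Mor (Perm t) (Xperm b) (Xperm d).

(* The condition defining the permutations attached to q; the orbit below does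
   not depend on the choice of such a permutation. *)
Definition represents (d b : Lambda) (q : Mat d b) (s : Sinf) : Prop :=
  forall i j : seg n, ~~ ((i == 1%N :> nat) && (j == 1%N :> nat)) ->
    (block d i `&` (s @` block b j) #= `I_(natv (q i j)))%card.

Definition xi_sigma (d b : Lambda) (q : Mat d b) : Sinf :=
  xget 1%g [set s | represents q s].

Definition xi_orbit (d b : Lambda) (q : Mat d b) : set (Xperm d * Xperm b) :=
  range (fun s : Sinf =>
    (pact s (Xpt d 1%g : Xperm d), pact s (Xpt b (xi_sigma q) : Xperm b))).

Lemma xi_subproof (d b : Lambda) (q : Mat d b) :
  (fun p => (`[< xi_orbit q p >])%:R : k^o)
    \in @orbit_const_pred k (Xperm b) (Xperm d).
Proof.
apply/asboolP => s y x; congr (_%:R); congr (nat_of_bool _).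
apply/asbool_equiv_eq; split => -[u _ /pair_equal_spec[uy ux]].
  by exists (s^-1 * u)%g => //; rewrite !pactM uy ux !pactK.
by exists (s * u)%g => //; rewrite !pactM uy ux.
Qed.

Definition xi (d b : Lambda) (q : Mat d b) : Xhom b d :=
  PermHom (xi_subproof q).

(* The index bd = (beta, delta) stands for Hom(X^beta, X^delta). *)
Definition Salg : lmodType k :=
  dsum (fun bd : Lambda * Lambda => Xhom bd.1 bd.2).

Definition Smul_fun (g f : Salg) :
    dprod (fun bd : Lambda * Lambda => Xhom bd.1 bd.2) :=
  fun bd => \sum_(c \in [set: Lambda])
    @Mcomp _ (Perm t) (Xperm bd.1) (Xperm c) (Xperm bd.2)
      (dsum_fun g (c, bd.2)) (dsum_fun f (bd.1, c)).

Lemma Smul_subproof (g f : Salg) : Smul_fun g f \in @finsupp_pred k _ _.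
Proof.
have /asboolP fing := valP g; have /asboolP finf := valP f.
apply/asboolP; apply: sub_finite_set (finite_image2
  (fun x y : Lambda * Lambda => (y.1, x.2)) fing finf) => -[b d] /= gf0.
apply: contrapT => gfN; case/eqP: gf0; apply: fsbig1 => c _ /=.
have [gcd0|gcd0] := eqVneq (dsum_fun g (c, d)) 0.
  by rewrite gcd0; apply: perm_comp0l.
have [fbc0|fbc0] := eqVneq (dsum_fun f (b, c)) 0.
  by rewrite fbc0; apply: perm_comp0r.
by case: gfN; exists (c, d) => //; exists (b, c).
Qed.

(* The product of the algebra S(n, t): components which are not composable
   do not contribute. *)
Definition Smul (g f : Salg) : Salg := Dsum (Smul_subproof g f).

Definition xiS (q : Mats) : Salg :=
  @dinj k _ (fun bd : Lambda * Lambda => Xhom bd.1 bd.2)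
    (col_sums q, row_sums q) (xi (Mats_Mat q)).

End combinatorics.

(* Main.v *)
(* A point of X^delta x X^beta is a pair of labellings of Omega by block
   indices, and its orbit is determined by the joint labelling
   Omega -> [1, n] x [1, n] up to a permutation of Omega. A labelling which is
   constant off a finite set is determined, up to a permutation, by the
   cardinals of its finite fibers; giving to its infinite fiber the weight which
   makes the total equal to t turns the joint labelling of a pair into the matrix
   q, whose row and column sums are the weights of the two labellings. Every
   admissible weight is realized, so the orbits are indexed by the matrices q.
   Evaluation at one point of each orbit is a family of functionals dual to the
   xi_q. *)
From HB Require Import structures.
Require Import Defs.
From mathcomp Require Import all_boot all_order all_algebra.
From mathcomp Require Import finmap.
From mathcomp Require Import boolp classical_sets functions cardinality fsbigop.
From mathcomp Require Import topology.

Set Implicit Arguments.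
Unset Strict Implicit.
Unset Printing Implicit Defensive.

Import Order.TTheory GRing.Theory Num.Theory.

Local Open Scope classical_set_scope.
Local Open Scope ring_scope.

(** * Finitely supported sums, cardinals of fibers, and the set [Omega] *)

Lemma fsbigT_supp (R : Type) (idx : R) (op : Monoid.com_law idx)
    (T : choiceType) (A : set T) (f : T -> R) :
    finite_set A -> (forall i, ~ A i -> f i = idx) ->
  \big[op/idx]_(i \in [set: T]) f i = \big[op/idx]_(i <- fset_set A) f i.
Proof.
move=> finA fA; apply: fsbigTE => i.
by rewrite in_fset_set // notin_setE => /fA.
Qed.
Arguments fsbigT_supp {R idx op T A f}.

(** Cancelling the common terms from the two equal totals leaves the values at [a]. This is how the
    entry at index 1, which need not be a natural number, is recovered from the others. *)
Lemma fsumT_eq_at (V : zmodType) (T : choiceType) (a : T) (f g : T -> V) :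
    finite_set [set i | f i != 0] -> finite_set [set i | g i != 0] ->
    \sum_(i \in [set: T]) f i = \sum_(i \in [set: T]) g i ->
    (forall i, i != a -> f i = g i) ->
  f = g.
Proof.
move=> finf fing fg fga; apply/funext => i; have [->|/fga//] := eqVneq i a.
pose A := a |` ([set i | f i != 0] `|` [set i | g i != 0]).
have finA : finite_set A by rewrite !finite_setU.
have Aa : a \in fset_set A by rewrite in_fset_set // inE; left.
move: fg; rewrite !(fsbigT_supp finA); last 2 first.
- by move=> j Aj; apply/eqP; apply: contra_notT Aj => fj; right; right.
- by move=> j Aj; apply/eqP; apply: contra_notT Aj => fj; right; left.
rewrite !(big_fsetD1 a Aa) /= => fg; apply: (addIr _ (etrans fg _)).
by congr (_ + _); apply: eq_big_seq => j; rewrite !inE => /andP[/fga].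
Qed.

Lemma card_eq_nat_inj (T : Type) (A : set T) (m p : nat) :
  (A #= `I_m)%card -> (A #= `I_p)%card -> m = p.
Proof.
by move=> Am Ap; apply/card_eq_II; apply: card_eq_trans Ap; rewrite card_eq_sym.
Qed.

(** The fibers partition both sides, so bijections chosen fiber by fiber glue to one global
    bijection. *)
Lemma bijective_fibers (S : Type) (T : pointedType) (I : Type)
    (h : S -> I) (h' : T -> I) :
    (forall i, (h @^-1` [set i] #= h' @^-1` [set i])%card) ->
  exists2 f : S -> T, bijective f & h' \o f =1 h.
Proof.
move=> hh'; have {hh'} F_ i : {f : S -> T |
    set_bij (h @^-1` [set i]) (h' @^-1` [set i]) f}.
  exact/cid/card_set_bijP.
pose f x := sval (F_ (h x)) x.
have fh : h' \o f =1 h.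
  by move=> x; rewrite /= /f; case: (F_ (h x)) => /= g [gf _ _]; apply: gf.
exists f => //; rewrite -setTT_bijective; split => // [x y _ _ fxy|y _].
  have hxy : h x = h y by rewrite -!fh /= fxy.
  move: fxy; rewrite /f hxy; case: (F_ (h y)) => /= g [_ gi _].
  by apply: gi; rewrite inE.
rewrite /f; have [] := svalP (F_ (h' y)) => _ _ /(_ y erefl)[x /= hx xy].
by exists x => //=; rewrite hx.
Qed.

Lemma card_eq_cofinite (T : countType) (A B : set T) :
  infinite_set [set: T] -> cofinite_set A -> cofinite_set B -> (A #= B)%card.
Proof.
move=> infT cA cB; have e (C : set T) : cofinite_set C -> (C #= [set: nat])%card.
  move=> cC; apply: eq_card_nat; first exact: countableP.
  exact: (cofinite_set_infinite infT).
by apply: (card_eq_trans (e A cA)); rewrite card_eq_sym; apply: e.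
Qed.

Definition natO (m : nat) : Omega := exist _ m.+1 isT.

Lemma natO_inj : injective natO.
Proof. by move=> m p /(congr1 (@seg_nat None)) []. Qed.

Lemma natOE (x : Omega) : natO (seg_nat x).-1 = x.
Proof. by apply: val_inj; rewrite /= prednK //; case/andP: (valP x). Qed.

HB.instance Definition _ := isPointed.Build Omega (natO 0).

Lemma infinite_Omega : infinite_set [set: Omega].
Proof.
apply/infiniteP/pcard_leTP/injPex; exists natO => x y _ _; exact: natO_inj.
Qed.

(** * Weights of labellings: computation, realization, classification up to bijection *)

Section weight.
Variables (k : fieldType) (t : k).

(* A labelling of Omega which takes the value a off a finite set has infinitely
   many points in its fiber over a; that fiber receives the weight which makes
   the total equal to t. *)
Definition weight (T : choiceType) (a : T) (l : Omega -> T) (i : T) : k :=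
  t * (i == a)%:R + \sum_(x \in [set: Omega]) ((i == l x)%:R - (i == a)%:R : k).

Definition fin_label (T : choiceType) (a : T) (l : Omega -> T) : Prop :=
  finite_set [set x | l x != a].

(** Points labelled [a] contribute zero, so every finite window [W] containing all other points
    gives the same sum. Weights of different labellings can then be compared over a common
    window. *)
Lemma weight_seq (T : choiceType) (a : T) (l : Omega -> T) (W : set Omega) i :
    finite_set W -> (forall x, l x != a -> W x) ->
  weight a l i =
  t * (i == a)%:R + \sum_(x <- fset_set W) ((i == l x)%:R - (i == a)%:R).
Proof.
move=> finW lW; congr (_ + _); apply: fsbigT_supp => // x Wx.
by have [->|/lW//] := eqVneq (l x) a; rewrite subrr.
Qed.

Lemma weight_neq (T : choiceType) (a : T) (l : Omega -> T) i m :
    fin_label a l -> i != a -> (l @^-1` [set i] #= `I_m)%card ->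
  weight a l i = m%:R.
Proof.
move=> finl ia lm; rewrite /weight (negPf ia) mulr0 add0r.
have fin : finite_set (l @^-1` [set i]) by apply/finite_setP; exists m.
rewrite (fsbigT_supp fin); last first.
  by move=> x /= lx; rewrite subr0; case: eqVneq => // /esym.
rewrite -(card_fset_set lm) -sum1_size natr_sum; apply: eq_big_seq => x.
by rewrite in_fset_set // inE /= => ->; rewrite eqxx subr0.
Qed.

Lemma weight_comp (T : choiceType) (a : T) (l : Omega -> T) (f : Omega -> Omega) :
  bijective f -> weight a (l \o f) = weight a l.
Proof.
by move=> bf; apply/funext => i; congr (_ + _); rewrite [RHS](reindex_fsbigT f).
Qed.

Lemma fin_label_comp (T : choiceType) (a : T) (l : Omega -> T) (f : Omega -> Omega) :
  injective f -> fin_label a l -> fin_label a (l \o f).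
Proof.
by move=> fI finl; apply: (finite_preimage _ finl); apply: in2W.
Qed.

Lemma finite_supp_weight (T : choiceType) (a : T) (l : Omega -> T) :
  fin_label a l -> finite_set [set i | weight a l i != 0].
Proof.
move=> finl; apply: (@sub_finite_set _ _ (a |` (l @` [set x | l x != a]))).
  move=> i; apply: contraPP => /not_orP[/eqP/negPf ia li].
  rewrite /= /weight ia mulr0 add0r fsbig1 ?eqxx // => x _.
  rewrite subr0; case: eqVneq => // ix; case: li; exists x => //=.
  by rewrite -ix ia.
by rewrite finite_setU; split=> //; apply: finite_image.
Qed.

(* With e = id and h constant this is the total weight; with e = pair i and
   h = fst it is a row sum. *)
Lemma weight_pushforward (J T U : choiceType) (a : T) (l : Omega -> T)
    (e : J -> T) (h : T -> U) (u : U) :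
    fin_label a l -> injective e -> (forall z, h z = u <-> exists j, e j = z) ->
  \sum_(j \in [set: J]) weight a l (e j) = weight (h a) (h \o l) u.
Proof.
move=> finl eI eh; pose C := a |` (l @` [set x | l x != a]).
have finC : finite_set C by rewrite finite_setU; split=> //; apply: finite_image.
have finB : finite_set (e @^-1` C) by apply: finite_preimage => //; apply: in2W.
(* Since [e] is injective with image the fiber of [h] over [u], exactly one [j] satisfies [e j = z]
   when [h z = u], and none otherwise. The set [C] holds every label in use, so the finite index set
   misses no such [j]. *)
have delta z : C z ->
    \sum_(j <- fset_set (e @^-1` C)) (e j == z)%:R = (u == h z)%:R :> k.
  move=> Cz; have [uhz|uhz] := eqVneq u (h z).
    have [j jz] := (eh z).1 (esym uhz).
    have jB : j \in fset_set (e @^-1` C).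
      by rewrite in_fset_set // inE /= jz.
    rewrite (big_fsetD1 j) //= jz eqxx big_seq big1 ?addr0 // => i.
    by rewrite !inE -jz (inj_eq eI) => /andP[/negPf->].
  rewrite big1 // => j _; case: eqVneq => // jz; case/eqP: uhz; apply/esym/eh.
  by exists j.
rewrite (fsbigT_supp finB); last first.
  move=> j Cj; have /negPf ja : e j != a by apply: contra_notN Cj => /eqP; left.
  rewrite /weight ja mulr0 add0r fsbig1 // => x _; rewrite subr0.
  case: eqVneq => // jx; case: Cj; right; exists x => //=.
  by rewrite -jx ja.
rewrite (@weight_seq _ _ _ [set x | l x != a]) //; last first.
  by move=> x; apply: contraNN => /= /eqP ->.
under eq_bigr do rewrite (weight_seq _ finl) //.
(* The term in [t] is [delta] at [a]; after exchanging the sums, each point [x] contributes [delta]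
   at [l x] minus [delta] at [a]. *)
rewrite big_split /= -mulr_sumr delta; last by left.
congr (_ + _); rewrite exchange_big; apply: eq_big_seq => x.
rewrite in_fset_set // inE /= => lx; rewrite sumrB !delta //; first by left.
by right; exists x.
Qed.

(** Pushing forward to a one-point set leaves a constant labelling, whose correction terms all
    vanish, so only [t] remains. *)
Lemma weight_total (T : choiceType) (a : T) (l : Omega -> T) :
  fin_label a l -> \sum_(i \in [set: T]) weight a l i = t.
Proof.
move=> finl; rewrite (@weight_pushforward T T unit _ _ id (fun=> tt) tt) //.
  by rewrite /weight eqxx mulr1 fsbig1 ?addr0 // => x _; rewrite subrr.
by move=> z; split=> // _; exists z.
Qed.

Lemma weight_eq (T : choiceType) (a : T) (l : Omega -> T) (q : T -> k) :
    fin_label a l -> finite_set [set i | q i != 0] ->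
    \sum_(i \in [set: T]) q i = t ->
    (forall i, i != a -> exists2 m, (l @^-1` [set i] #= `I_m)%card & q i = m%:R) ->
  weight a l = q.
Proof.
move=> finl finq qt lq; apply: (@fsumT_eq_at _ _ a) => //.
- exact: finite_supp_weight.
- by rewrite weight_total.
by move=> i ia; have [m lm ->] := lq i ia; apply: weight_neq.
Qed.

Lemma fin_label_fiber (T : choiceType) (a : T) (l : Omega -> T) i :
  fin_label a l -> i != a -> finite_set (l @^-1` [set i]).
Proof. by move=> finl ia; apply: sub_finite_set finl => x /= ->. Qed.

(** List each label [i] other than [a] with multiplicity [m i], label the first points of [Omega] by
    this list, and use [a] as the default beyond its end. *)
Lemma label_fibers (T : choiceType) (a : T) (m : T -> nat) :
    finite_set [set i | m i != 0%N] ->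
  exists2 l : Omega -> T, fin_label a l &
    forall i, i != a -> (l @^-1` [set i] #= `I_(m i))%card.
Proof.
move=> finm; pose S := fset_set ([set i | m i != 0%N] `\ a).
have finS : finite_set ([set i | m i != 0%N] `\ a) by apply: finite_setD.
pose L := flatten [seq nseq (m i) i | i <- S].
have cL i : i != a -> count_mem i L = m i.
  move=> ia; rewrite count_flatten -map_comp sumnE big_map.
  have [iS|iS] := boolP (i \in S).
    rewrite (big_fsetD1 i iS) /= count_nseq /= eqxx mul1n big_seq big1 ?addn0 //.
    by move=> j; rewrite !inE count_nseq /= => /andP[/negPf->].
  have m0 : m i = 0%N.
    apply/eqP; apply: contraNT iS => mi; rewrite in_fset_set // inE; split=> //.
    exact/eqP.
  rewrite m0 big_seq big1 // => j jS /=; rewrite count_nseq /=.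
  by case: eqVneq jS iS => [-> ->|].
pose l (x : Omega) := nth a L x.-1.
pose s := map natO (iota 0 (size L)).
have ls x : l x != a -> x \in s.
  move=> lx; apply/mapP; exists (seg_nat x).-1; last by rewrite natOE.
  rewrite mem_iota /= add0n ltnNge; apply: contra lx => Lx.
  by rewrite /l nth_default.
have lS : map l s = L.
  by rewrite -map_comp -[RHS](mkseq_nth a); apply: eq_map.
have finl : fin_label a l by apply: sub_finite_set (finite_seq s).
exists l => // i ia; have fin := fin_label_fiber finl ia.
rewrite -(fset_setK fin); apply/card_eq_fsetP.
rewrite -(cL _ ia) -lS count_map -size_filter; apply/perm_size/uniq_perm => //.
  by rewrite filter_uniq // map_inj_uniq ?iota_uniq //; apply: natO_inj.
move=> x; rewrite in_fset_set // mem_filter /=; apply/idP/andP.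
  by rewrite inE /= => lx; rewrite lx eqxx ls ?lx.
by rewrite inE => -[/eqP].
Qed.

Hypothesis hk : [pchar k] =i pred0.

Lemma natr_pchar0_inj : injective (fun m : nat => m%:R : k).
Proof.
have h (m p : nat) : (m <= p)%N -> m%:R = p%:R :> k -> m = p.
  move=> mp /eqP; rewrite eq_sym -subr_eq0 -natrB // ((pcharf0P _).1 hk).
  rewrite subn_eq0 => pm.
  by apply/eqP; rewrite eqn_leq mp.
by move=> m p mp; case: (leqP m p) => [|/ltnW] /h -> //.
Qed.

(** Fibers of the prescribed sizes exist away from [a]; the value at [a] then agrees because both
    totals are [t]. *)
Lemma weight_realize (T : choiceType) (a : T) (q : T -> k) :
    (forall i, i != a -> is_nat (q i)) -> finite_set [set i | q i != 0] ->
    \sum_(i \in [set: T]) q i = t ->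
  exists2 l : Omega -> T, fin_label a l & weight a l = q.
Proof.
move=> qn finq qt.
have /choice[m qm] i : exists p : nat, i != a -> q i = p%:R.
  by have [->|/qn[p qp]] := eqVneq i a; [exists 0%N|exists p].
(* The choice [m] is arbitrary at [a]; resetting it to 0 there keeps the support inside that of
   [q]. *)
pose m' i := if i == a then 0%N else m i.
have finm' : finite_set [set i | m' i != 0%N].
  apply: sub_finite_set finq => i; rewrite /= /m'; case: (eqVneq i a) => // ia.
  by rewrite qm // ((pcharf0P _).1 hk).
have [l finl lm] := label_fibers a finm'; exists l => //.
apply: weight_eq => // i ia; exists (m' i); first exact: lm.
by rewrite /m' (negPf ia) qm.
Qed.

(** In characteristic zero the weight away from [a] determines the size of the finite fiber. The
    fibers over [a] are both cofinite in a countably infinite set, hence equipotent, and the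
    fiberwise bijections glue. *)
Lemma weight_transport (T : choiceType) (a : T) (l l' : Omega -> T) :
    fin_label a l -> fin_label a l' -> weight a l = weight a l' ->
  exists2 f : Omega -> Omega, bijective f & l' \o f =1 l.
Proof.
move=> finl finl' ll'; apply: bijective_fibers => i.
have [->|ia] := eqVneq i a.
  have cof r : fin_label a r -> cofinite_set (r @^-1` [set a]).
    by apply: sub_finite_set => x /eqP.
  by apply: card_eq_cofinite; [exact: infinite_Omega|exact: cof|exact: cof].
have [[m lm] [m' lm']] := (fin_label_fiber finl ia, fin_label_fiber finl' ia).
apply: (card_eq_trans lm); rewrite card_eq_sym (_ : m = m') //.
apply: natr_pchar0_inj.
by rewrite -(weight_neq finl ia lm) -(weight_neq finl' ia lm') ll'.
Qed.

Lemma natv_nat m : natv (m%:R : k) = m.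
Proof.
rewrite /natv; case: pselect => [e|[]]; last by exists m.
by case: ex_minnP => p /eqP/natr_pchar0_inj ->.
Qed.

End weight.

(** * The index 1 and intervals of integers *)

Lemma Sinf_of_bijective (f : Omega -> Omega) :
  bijective f -> exists s : Sinf, forall x, s x = f x.
Proof. by move=> bf; exists (exist _ f (introT (asboolP _) bf)). Qed.

(** Closed transparently, so that its underlying number computes to 1. *)
Definition seg_one n (hn : n != Some 0%N) : seg n.
Proof. by exists 1%N; case: n hn => [[]|]. Defined.

Lemma eq_seg_one n (hn : n != Some 0%N) (i : seg n) :
  (i == 1%N :> nat) = (i == seg_one hn).
Proof. by apply/eqP/eqP => [i1|->//]; apply: val_inj. Qed.

Lemma seg_gt1 n (hn : n != Some 0%N) (i : seg n) :
  (2 <= i)%N = (i != seg_one hn).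
Proof.
by rewrite -eq_seg_one ltn_neqAle eq_sym; case/andP: (valP i) => ->; rewrite andbT.
Qed.

Lemma finite_seg_le n m : finite_set [set i : seg n | (2 <= i <= m)%N].
Proof.
apply: (@sub_finite_set _ _ (@seg_nat n @^-1` `I_m.+1)).
  by move=> i /andP[_ im].
by apply: finite_preimage => //; apply: in2W => i j; apply: val_inj.
Qed.

Lemma card_Omega_interval p m :
  ([set x : Omega | (1 + p <= x <= p + m)%N] #= `I_m)%card.
Proof.
rewrite (_ : mkset _ = (fun r => natO (p + r)) @` `I_m).
  by apply: inj_card_eq => x y _ _ /natO_inj/addnI.
apply/seteqP; split => [x|_ [r /= rm <-]] /=; last first.
  by rewrite add1n ltnS leq_addr ltn_add2l.
rewrite -[x]natOE; move: x.-1 => r /=; rewrite add1n ltnS => /andP[pr rm].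
by exists (r - p)%N; rewrite /= ?subnKC // ltn_subLR.
Qed.

(** * Blocks as fibers of a labelling of [Omega] *)

Section labels.
Variables (k : fieldType) (hk : [pchar k] =i pred0) (t : k).
Variables (n : option nat) (hn : n != Some 0%N).
Local Notation a := (seg_one hn).
Implicit Types (b d : Lambda t n) (i j : seg n).

Lemma Lambda_natv b i : i != a -> b i = (natv (b i))%:R.
Proof.
move=> ia; have /asboolP[/(_ i) + _ _] := valP b.
rewrite (eq_seg_one hn) (negPf ia) => -[m bm]; have {}bm : b i = m%:R by [].
by rewrite bm natv_nat.
Qed.

Lemma psum_step b (i : seg n) : (2 <= i)%N ->
  psum b i = (psum b i.-1 + natv (b i))%N.
Proof.
move=> i2; rewrite /psum (fsbigD1 i) /=; last 2 first.
- exact: finite_seg_le.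
- by rewrite i2 leqnn.
rewrite addnC; congr (_ + _)%N; apply: eq_fsbigl; apply/seteqP; split => j /=.
  move=> [/andP[j2 ji] jni]; rewrite j2 /= -ltnS (ltn_predK i2) ltn_neqAle ji andbT.
  by apply/eqP => /val_inj.
rewrite -(ltnS (seg_nat j)) (ltn_predK i2) => /andP[j2 ji].
rewrite j2 ltnW //; split=> // e.
by rewrite e ltnn in ji.
Qed.

Lemma leq_psum b m p : (m <= p)%N -> (psum b m <= psum b p)%N.
Proof.
move=> mp; rewrite /psum.
rewrite [leqRHS](fsbigID [set i : seg n | (i <= m)%N]) /=; last first.
  exact: finite_seg_le.
apply: leq_trans (leq_addr _ _).
rewrite (_ : _ `&` _ = [set i : seg n | 2 <= i <= m]%N) //.
apply/seteqP; split => i /=; first by move=> [/andP[->]].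
by move=> /andP[-> im]; rewrite im (leq_trans im mp).
Qed.

Lemma card_interval b i : i != a -> (Defs.interval b i #= `I_(natv (b i)))%card.
Proof.
rewrite -seg_gt1 => i2; rewrite /Defs.interval psum_step //.
exact: card_Omega_interval.
Qed.

Lemma interval_disjoint b (i j : seg n) x :
  i != a -> j != a -> Defs.interval b i x -> Defs.interval b j x -> i = j.
Proof.
move=> ia ja xi xj; apply: val_inj.
wlog ij : i j ia ja xi xj / (i < j)%N.
  move=> h; case: (ltngtP i j) => // ij; first exact: h.
  by apply/esym/h.
case/andP: xi xj => _ xi /andP[xj _].
suff : (psum b i < psum b i)%N by rewrite ltnn.
apply: leq_trans (leq_trans _ xj) xi => //.
by rewrite add1n ltnS leq_psum // -ltnS prednK ?(leq_trans _ ij).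
Qed.

Lemma block_one b : block b a = ~` \bigcup_(i in [set i | i != a]) Defs.interval b i.
Proof.
rewrite /block /= (_ : [set i : seg n | (2 <= i)%N] = [set i | i != a]) //.
by apply/funext => i; rewrite /= (seg_gt1 hn).
Qed.

Lemma block_neq b i : i != a -> block b i = Defs.interval b i.
Proof. by rewrite /block (eq_seg_one hn) => /negPf->. Qed.

Lemma block_ex b x : exists i, block b i x.
Proof.
have [[i ia xi]|xN] :=
    pselect ((\bigcup_(i in [set i | i != a]) Defs.interval b i) x).
  by exists i; rewrite block_neq.
by exists a; rewrite block_one.
Qed.

Lemma block_uniq b x i j : block b i x -> block b j x -> i = j.
Proof.
have [->|ia] := eqVneq i a; have [-> //|ja] := eqVneq j a.
- by rewrite block_one block_neq // => xN xj; case: xN; exists j.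
- by rewrite block_one block_neq // => xi xN; case: xN; exists i.
- by rewrite !block_neq //; apply: interval_disjoint.
Qed.

Definition lab b (x : Omega) : seg n := xget a [set i | block b i x].

Lemma labE b x i : (lab b x = i) = block b i x.
Proof.
have [j xj] := block_ex b x; rewrite /lab; case: xgetP => [i' -> xi'|/(_ j)//].
by rewrite propeqE; split => [<-//|]; apply: block_uniq.
Qed.

Lemma lab_preimage b i : lab b @^-1` [set i] = block b i.
Proof. by apply/seteqP; split => x /=; rewrite labE. Qed.

Lemma fin_lab b : fin_label a (lab b).
Proof.
have /asboolP[_ finb _] := valP b.
apply: (@sub_finite_set _ _
  (\bigcup_(i in [set i | b i != 0] `\ a) Defs.interval b i)).
  move=> x /= xa; have := erefl (lab b x); rewrite labE block_neq // => xi.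
  exists (lab b x) => //; split; last exact/eqP.
  apply/eqP => b0; have := card_interval b xa.
  rewrite b0 (natv_nat hk 0) II0 card_eq0 => /eqP i0.
  by rewrite i0 in xi.
apply: bigcup_finite; first exact: finite_setD.
move=> i [_ /eqP ia]; apply/finite_setP; exists (natv (b i)).
exact: card_interval.
Qed.

(** Identifies a sequence with the weight of its block labelling, so that facts on weights apply to
    the sums of a matrix. *)
Lemma weight_lab b : weight t a (lab b) = b.
Proof.
have /asboolP[_ finb bt] := valP b; apply: weight_eq => //; first exact: fin_lab.
move=> i ia; exists (natv (b i)); last exact: Lambda_natv.
by rewrite lab_preimage block_neq //; apply: card_interval.
Qed.

(** Turns the setwise condition on blocks into invariance of a function, the form in which
    bijections between labellings are produced. *)
Lemma SblockE b s : Sblock b s <-> forall x, lab b (s x) = lab b x.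
Proof.
split=> [bs x|bs j].
  rewrite labE -[block _ _](bs (lab b x)); exists x => //.
  by rewrite -labE.
apply/seteqP; split => [_ [x xj <-]|x xj]; first by rewrite -labE bs labE.
by exists (Sinf_fun s^-1%g x); rewrite ?Sinf_VK // -labE -bs Sinf_VK labE.
Qed.

Lemma XptE b s u : Xpt b s = Xpt b u <-> Sblock b (s^-1 * u)%g.
Proof.
split=> [/(congr1 val) /= su|]; last first.
  by move=> /(Xpt_mulr s); rewrite mulVKg => ->.
have : lcoset (Sblock b) u u by exists 1%g; rewrite ?mulg1 //; apply/SblockE.
by rewrite -su => -[v bv <-]; rewrite mulKg.
Qed.

(** * Joint labellings, double cosets and orbits of pairs *)

Definition pair_lab b d (s : Sinf) (x : Omega) : seg n * seg n :=
  (lab d x, lab b (Sinf_fun s^-1%g x)).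

Lemma fin_pair_lab b d s : fin_label (a, a) (pair_lab b d s).
Proof.
apply: (@sub_finite_set _ _ ([set x | lab d x != a] `|`
    [set x | (lab b \o Sinf_fun s^-1%g) x != a])).
  by move=> x /=; rewrite xpair_eqE negb_and => /orP.
rewrite finite_setU; split; first exact: fin_lab.
by apply: (fin_label_comp (l := lab b)); [exact: Sinf_inj|exact: fin_lab].
Qed.

Lemma pair_lab_preimage b d s i j :
  pair_lab b d s @^-1` [set (i, j)] = block d i `&` (s @` block b j).
Proof.
apply/seteqP; split => x /=.
  move=> [xi xj]; split; first by rewrite -labE.
  by exists (Sinf_fun s^-1%g x); rewrite ?Sinf_VK // -labE.
move=> [+ [y + yx]]; rewrite -!labE => xi yj.
by rewrite /pair_lab -yx Sinf_KV yx xi yj.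
Qed.

Definition Mat_uncurry b d (q : Mat d b) (ij : seg n * seg n) : k := q ij.1 ij.2.

Lemma Mat_uncurry_inj b d : injective (@Mat_uncurry b d).
Proof.
move=> q q' qq'; apply/val_inj/funext => i; apply/funext => j.
exact: (congr1 (fun f => f (i, j)) qq').
Qed.

Lemma Mat_is_nat b d (q : Mat d b) ij : ij != (a, a) -> is_nat (Mat_uncurry q ij).
Proof.
case: ij => i j; rewrite xpair_eqE => /negPf ij.
by have /asboolP[/(_ i j) + _ _ _ _] := valP q; rewrite !(eq_seg_one hn) ij.
Qed.

Lemma represents_fiber b d (q : Mat d b) s i j :
    represents q s -> (i, j) != (a, a) ->
  (pair_lab b d s @^-1` [set (i, j)] #= `I_(natv (q i j)))%card.
Proof.
move=> qs ij; rewrite pair_lab_preimage; apply: qs.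
by rewrite !(eq_seg_one hn) -xpair_eqE.
Qed.

(** The fibers of the joint labelling are the intersections of blocks counted by [represents], and
    the remaining entry at (1,1) is fixed on both sides by the total [t]. *)
Lemma representsE b d (q : Mat d b) s :
  represents q s <-> weight t (a, a) (pair_lab b d s) = Mat_uncurry q.
Proof.
have finl := fin_pair_lab b d s; have /asboolP[qn finq qt _ _] := valP q.
split=> [qs|wq i j ij].
  apply: weight_eq => // -[i j] ij; exists (natv (q i j)).
    exact: represents_fiber.
  have [m qm] := Mat_is_nat q ij.
  by rewrite qm -[in RHS]/(Mat_uncurry q (i, j)) qm natv_nat.
have {}ij : (i, j) != (a, a) by rewrite xpair_eqE -!eq_seg_one.
have [m lm] := fin_label_fiber finl ij.
have := weight_neq t finl ij lm; rewrite wq -pair_lab_preimage => qm.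
by rewrite -[q i j]/(Mat_uncurry q (i, j)) qm natv_nat.
Qed.

(** Realize [q] as the weight of a labelling [l] by pairs. By pushforward the components of [l] have
    weights [d] and [b], so they differ from the block labellings by permutations [f] and [g], and
    [f * g^-1] represents [q]. *)
Lemma represents_exists b d (q : Mat d b) : exists s, represents q s.
Proof.
have /asboolP[qn finq qt qb qd] := valP q.
have [l finl lq] := weight_realize hk (@Mat_is_nat _ _ q) finq qt.
have side (h : seg n * seg n -> seg n) (c : Lambda t n) :
    h (a, a) = a -> weight t a (h \o l) = c ->
    exists f : Sinf, forall x, lab c (f x) = h (l x).
  move=> ha hl; have finhl : fin_label a (h \o l).
    by apply: sub_finite_set finl => x; apply: contraNN => /eqP /= ->; rewrite ha.
  have [|f bf fh] := weight_transport hk finhl (fin_lab c) (t := t).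
    by rewrite hl weight_lab.
  by have [s sf] := Sinf_of_bijective bf; exists s => x; rewrite sf; apply: fh.
have [||f fd] := side fst d.
- by [].
- apply/funext => i; rewrite -qd -[a]/((a, a).1).
  rewrite -(@weight_pushforward _ t _ _ _ _ _ (pair i)) ?lq //.
    by move=> ? ? [].
  by move=> [i' j]; split => [<-|[? [->]]] //; exists j.
have [||g gb] := side snd b.
- by [].
- apply/funext => j; rewrite -qb -[a]/((a, a).2).
  rewrite -(@weight_pushforward _ t _ _ _ _ _ (pair^~ j)) ?lq //.
    by move=> ? ? [].
  by move=> [i j']; split => [<-|[? [_ ->]]] //; exists i.
(* The joint labelling of this permutation is [l] composed with the inverse of [f], which has the
   same weight as [l]. *)
exists (f * g^-1)%g; apply/representsE; rewrite -lq.
rewrite -[RHS](weight_comp t (a, a) l (Sinf_bij f^-1%g)); congr weight.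
apply/funext => x; rewrite /pair_lab invgM invgK Sinf_mulE gb /=.
by rewrite -{1}[x](Sinf_VK f) fd; case: (l _).
Qed.

Lemma represents_Mat b d (s : Sinf) : exists q : Mat d b, represents q s.
Proof.
have finl := fin_pair_lab b d s; pose w := weight t (a, a) (pair_lab b d s).
suff wP : `[< Mat_pred d b (fun i j => w (i, j)) >].
  exists (exist (fun q => is_true `[< Mat_pred d b q >]) _ wP); apply/representsE.
  by apply/funext => -[].
apply/asboolP; split.
- move=> i j; rewrite !(eq_seg_one hn) -xpair_eqE; case: eqVneq => [->|ij].
    (* At (1,1) the weight is [t] minus the number of points carrying any other label. *)
    exists (#|` fset_set [set x | pair_lab b d s x != (a, a)]|)%:Z.
    rewrite /w (weight_seq t _ finl) // eqxx mulr1; congr (_ + _).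
    rewrite -pmulrn -sum1_size natr_sum -sumrN; apply: eq_big_seq => x.
    by rewrite in_fset_set // inE /= eq_sym => /negPf->; rewrite sub0r.
  by have [m lm] := fin_label_fiber finl ij; exists m; apply: weight_neq lm.
- by rewrite (_ : mkset _ = [set ij | w ij != 0]);
    [exact: finite_supp_weight|apply/seteqP; split => -[]].
- by rewrite -[RHS](weight_total t finl); apply: eq_fsbigr => -[].
- move=> j; rewrite (@weight_pushforward _ t _ _ _ _ _ (pair^~ j) snd j) //.
  + rewrite -[in RHS](weight_lab b) -[in RHS](weight_comp t a _ (Sinf_bij s^-1%g)).
    by congr weight; apply/funext.
  + by move=> ? ? [].
  + by move=> [i j']; split => [<-|[? [_ ->]]] //; exists i.
- move=> i; rewrite (@weight_pushforward _ t _ _ _ _ _ (pair i) fst i) //.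
  + by rewrite -[in RHS](weight_lab d).
  + by move=> ? ? [].
  + by move=> [i' j]; split => [<-|[? [->]]] //; exists j.
Qed.

(** Equal weights give a bijection [w] carrying one joint labelling to the other. Its first
    component says that [w] preserves the [d] blocks, its second that [u^-1 * (w * s)] preserves the
    [b] blocks: [s] and [u] share a double coset. *)
Lemma represents_uniq b d (q : Mat d b) s u : represents q s -> represents q u ->
  exists2 w, Sblock d w & Sblock b (u^-1 * (w * s))%g.
Proof.
move=> /representsE ws /representsE wu.
have [|||f bf fE] :=
  @weight_transport _ t hk _ (a, a) (pair_lab b d s) (pair_lab b d u).
- exact: fin_pair_lab.
- exact: fin_pair_lab.
- by rewrite ws wu.
have [w wf] := Sinf_of_bijective bf; exists w; apply/SblockE => x.
  by rewrite wf; have /(congr1 fst) := fE x.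
rewrite !Sinf_mulE wf.
by have /(congr1 snd) /= := fE (s x); rewrite Sinf_KV.
Qed.

(** Up to the bijection [w], the joint labelling is unchanged when [s] moves within its double
    coset. *)
Lemma represents_mul b d (q : Mat d b) s w v :
  represents q s -> Sblock d w -> Sblock b v -> represents q (w * s * v)%g.
Proof.
move=> /representsE ws /SblockE dw /SblockE bv; apply/representsE.
rewrite -ws -[RHS](weight_comp t (a, a) _ (Sinf_bij w^-1%g)); congr weight.
apply/funext => x; rewrite /pair_lab /= !invgM !Sinf_mulE; congr pair.
  by rewrite -{1}[x](Sinf_VK w) dw.
by rewrite -bv Sinf_VK.
Qed.

Lemma represents_inj b d (q q' : Mat d b) s :
  represents q s -> represents q' s -> q = q'.
Proof.
by move=> /representsE qs /representsE q's; apply: Mat_uncurry_inj; rewrite -qs.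
Qed.

Lemma xi_sigmaP b d (q : Mat d b) : represents q (xi_sigma q).
Proof.
by rewrite /xi_sigma; case: xgetP => // N; have [s /N] := represents_exists q.
Qed.

Definition base_pt b d (q : Mat d b) : Xperm d * Xperm b :=
  (Xpt d 1%g, Xpt b (xi_sigma q)).

Lemma xi_base_pt b d (q q' : Mat d b) :
  (xi q' : Xhom b d) (base_pt q) = (q' == q)%:R.
Proof.
rewrite /=; congr (nat_of_bool _)%:R.
apply/asboolP/eqP => [[s _ /pair_equal_spec[]]|->].
  rewrite /pact /= !XactE => /esym/XptE; rewrite invg1 mul1g mulg1 => ds /XptE bs.
  apply: (represents_inj _ (xi_sigmaP q)).
  by have := represents_mul (xi_sigmaP q') ds bs; rewrite mulVKg.
by exists 1%g => //; rewrite !pact1.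
Qed.

(** For the pair of cosets of [u] and [v], take the matrix of [u^-1 * v]; the element [w] relating
    it to the chosen representative makes [u * w] carry the base point to the pair. *)
Lemma base_pt_orbit b d p : exists q : Mat d b, exists s,
  p = (pact s (base_pt q).1, pact s (base_pt q).2).
Proof.
case: p => y x; have [u ->] := XsetP y; have [v ->] := XsetP x.
have [q qs] := represents_Mat b d (u^-1 * v)%g.
have [w dw bw] := represents_uniq (xi_sigmaP q) qs.
exists q, (u * w)%g; rewrite /= !XactE mulg1; congr pair.
  by rewrite Xpt_mulr.
by apply/XptE; move: bw; rewrite invgM invgK !mulgA.
Qed.

End labels.

(** * Bases from dual families of functionals *)

Section dual_basis.
Variables (k : fieldType) (V : lmodType k) (I : choiceType).
Variables (v : I -> V) (phi : I -> V -> k^o).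
Hypothesis phi_linear : forall i, linear (phi i).
Hypothesis phi_dual : forall i j, phi i (v j) = (j == i)%:R.

Lemma phi_fsum c i : finite_set [set j | c j != 0] ->
  phi i (\sum_(j \in [set: I]) c j *: v j) = c i.
Proof.
move=> finc; have phi0 : phi i 0 = 0.
  by have := phi_linear i (-1) 0 0; rewrite scaler0 addr0 scaleN1r addNr.
rewrite (fsbigT_supp finc); last first.
  by move=> j /= /negP; rewrite negbK => /eqP ->; rewrite scale0r.
rewrite (big_morph (phi i) (id1 := 0) (op1 := +%R)) //; last first.
  by move=> x y; have := phi_linear i 1 x y; rewrite !scale1r.
rewrite (eq_bigr (fun j => c j * (j == i)%:R)); last first.
  by move=> j _; rewrite -[c j *: _]addr0 phi_linear phi0 addr0 phi_dual.
have [ci|] := boolP (c i != 0).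
  rewrite (big_fsetD1 i) /=; last by rewrite in_fset_set // inE.
  rewrite eqxx mulr1 big_seq big1 ?addr0 // => j.
  by rewrite !inE => /andP[/negPf-> _]; rewrite mulr0.
rewrite negbK => /eqP ci; rewrite ci big1 // => j _.
by case: eqVneq => [->|]; rewrite ?ci ?mul0r ?mulr0.
Qed.

(** The functionals read off coefficients, which gives independence. For spanning, [x] minus its
    expansion with coefficients [phi i x] is killed by every functional, hence zero. *)
Lemma dual_is_basis :
    (forall x, finite_set [set i | phi i x != 0]) ->
    (forall x, (forall i, phi i x = 0) -> x = 0) ->
  is_basis v.
Proof.
move=> fin_phi sep; split => [c finc c0 i|x].
  have /= <- := phi_fsum i finc; rewrite c0.
  by have := phi_linear i (-1) 0 0; rewrite scaler0 addr0 scaleN1r addNr.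
exists (phi^~ x); first exact: fin_phi.
apply/eqP; rewrite -subr_eq0 addrC; apply/eqP; apply: sep => i.
by rewrite -scaleN1r phi_linear (phi_fsum i (fin_phi x)) scaleN1r addNr.
Qed.

End dual_basis.

Lemma finite_basis_dim (k : fieldType) (V : lmodType k) (I : choiceType)
    (v : I -> V) :
  finite_set [set: I] -> is_basis v -> finite_dimensional V.
Proof.
move=> finI [v_free v_span]; pose s := fset_set [set: I] : seq I.
have Is x : x \in s by rewrite in_fset_set // inE.
have f_bij : bijective (tnth (in_tuple s)).
  pose g x := Ordinal (etrans (index_mem x s) (Is x)).
  have fg x : tnth (in_tuple s) (g x) = x by rewrite (tnth_nth x) nth_index.
  have /tuple_uniqP f_inj : uniq (in_tuple s) by rewrite /= /s fset_uniq.
  by exists g => // i; apply: f_inj.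
have [g gK Kg] := f_bij; exists (size s), (v \o tnth (in_tuple s)).
split=> [c _|x].
  move=> c0 i; rewrite -[i]gK; apply: (v_free (c \o g)).
    exact: sub_finite_set finI.
  rewrite (reindex_fsbigT _ _ f_bij) -[RHS]c0; apply: eq_fsbigr => j _.
  by rewrite /= gK.
have [c _ ->] := v_span x; exists (c \o tnth (in_tuple s)).
  exact: finite_finset.
by rewrite (reindex_fsbigT _ _ f_bij).
Qed.

(** * Finitely many matrices with given row and column sums *)

Section finiteness.
Variables (k : fieldType) (hk : [pchar k] =i pred0) (t : k).
Variables (n : option nat) (hn : n != Some 0%N).
Local Notation a := (seg_one hn).
Implicit Types (b d : Lambda t n) (i j : seg n).

Lemma finite_range_lab b : finite_set (range (lab hn b)).
Proof.
apply: (@sub_finite_set _ _ (a |` (lab hn b @` [set x | lab hn b x != a]))).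
  move=> _ [x _ <-]; have [->|xa] := eqVneq (lab hn b x) a; first by left.
  by right; exists x.
by rewrite finite_setU; split => //; apply: finite_image; apply: (fin_lab hk).
Qed.

Lemma card_lab b i : i != a ->
  (lab hn b @^-1` [set i] #= `I_(natv (b i)))%card.
Proof. by move=> ia; rewrite lab_preimage // block_neq //; apply: card_interval. Qed.

Lemma finite_Mat b d : finite_set [set: Mat d b].
Proof.
pose E := fset_set (range (lab hn d)); pose E' := fset_set (range (lab hn b)).
(* An entry other than (1,1) has its row or its column index different from 1, so it is bounded by
   the size of a finite block of [d] or of [b]; the sum of both maxima covers the two cases. *)
pose N := (\max_(i <- E) natv (d i) + \max_(j <- E') natv (b j))%N.
pose F (q : Mat d b) : {ffun E * E' -> 'I_N.+1} :=
  [ffun z => inord (natv (q (val z.1) (val z.2)))].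
have q_out (q : Mat d b) i j : (i, j) != (a, a) ->
    ~ (range (lab hn d) i /\ range (lab hn b) j) -> natv (q i j) = 0%N.
  move=> ij ijN; have [s qs] := represents_exists hk hn q.
  apply: (card_eq_nat_inj (represents_fiber qs ij)); rewrite II0 card_eq0.
  by apply/eqP/seteqP; split => // x -[xi xj]; case: ijN; split;
    [exists x|exists (Sinf_fun s^-1%g x)].
have q_le (q : Mat d b) i j : range (lab hn d) i -> range (lab hn b) j ->
    (i, j) != (a, a) -> (natv (q i j) <= N)%N.
  move=> ri rj ij; have [s qs] := represents_exists hk hn q.
  have := represents_fiber qs ij; rewrite xpair_eqE negb_and in ij.
  have finE := finite_range_lab d; have finE' := finite_range_lab b.
  case/orP: ij => [ia|ja] /card_eqPle[_ qle].
    have dN : (natv (d i) <= \max_(i <- E) natv (d i))%N.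
      by apply: leq_bigmax_seq; rewrite ?in_fset_set ?inE.
    apply: leq_trans (leq_trans dN (leq_addr _ _)).
    rewrite -card_le_II; apply: card_le_trans qle _.
    rewrite -(card_le_eqr (card_lab d ia)); apply: subset_card_le.
    by move=> x [].
  have bN : (natv (b j) <= \max_(j <- E') natv (b j))%N.
    by apply: leq_bigmax_seq; rewrite ?in_fset_set ?inE.
  apply: leq_trans (leq_trans bN (leq_addl _ _)).
  rewrite -card_le_II; apply: card_le_trans qle _.
  rewrite -(card_le_eqr (card_lab b ja)).
  apply: card_le_trans (card_image_le s _); apply: subset_card_le.
  by move=> x [_ xj]; exists (Sinf_fun s^-1%g x) => //; rewrite Sinf_VK.
(* The encoding need not be faithful at (1,1), where [natv] may be a default value or be truncated
   by [inord]; that entry is recovered from the total [t]. *)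
have F_inj : injective F.
  move=> q q' FF; apply: Mat_uncurry_inj.
  have /asboolP[_ finq qt _ _] := valP q; have /asboolP[_ finq' qt' _ _] := valP q'.
  apply: (@fsumT_eq_at _ _ (a, a)) => //; first by rewrite qt qt'.
  move=> [i j] ij; have [m qm] := Mat_is_nat q ij; have [m' qm'] := Mat_is_nat q' ij.
  suff : natv (q i j) = natv (q' i j).
    rewrite qm qm' -[q i j]/(Mat_uncurry q (i, j)) -[q' i j]/(Mat_uncurry q' (i, j)).
    by rewrite qm qm' !natv_nat // => ->.
  have [[ri rj]|ijN] := pselect (range (lab hn d) i /\ range (lab hn b) j);
    last first.
    by rewrite !q_out.
  have iE : i \in E by rewrite in_fset_set ?inE //; apply: finite_range_lab.
  have jE : j \in E' by rewrite in_fset_set ?inE //; apply: finite_range_lab.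
  move/ffunP: FF => /(_ (FSetSub iE, FSetSub jE)); rewrite !ffunE /=.
  by move/(congr1 val); rewrite /= !inordK // ltnS q_le.
apply: (@sub_finite_set _ _ (F @^-1` setT)) => //.
by apply: finite_preimage finite_finset; apply: in2W.
Qed.

End finiteness.

(** * The bases of the Hom spaces and of their direct sum *)

Section main.
Variables (k : fieldType) (hk : [pchar k] =i pred0) (t : k).
Variables (n : option nat) (hn : n != Some 0%N).
Local Notation a := (seg_one hn).
Implicit Types (b d : Lambda t n).

Lemma eq0_base_pt b d (f : Xhom b d) :
  (forall q : Mat d b, (f : perm_hom k _ _) (base_pt q) = 0) -> f = 0.
Proof.
move=> f0; apply/val_inj/funext => p /=.
have [q [s ->]] := base_pt_orbit hk hn p.
by rewrite perm_homP -surjective_pairing f0.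
Qed.

Lemma xi_basis b d : is_basis (fun q : Mat d b => xi q : Xhom b d).
Proof.
apply: (@dual_is_basis _ _ _ _
  (fun q (f : Xhom b d) => (f : perm_hom k _ _) (base_pt q))).
- by [].
- by move=> q q'; exact: (xi_base_pt hk hn).
- by move=> f; apply: sub_finite_set (finite_Mat hk hn b d).
- exact: eq0_base_pt.
Qed.

Lemma Mats_of_subproof b d (q : Mat d b) :
  `[< exists d b : Lambda t n, Mat_pred d b (sval q) >].
Proof. by apply/asboolP; exists d, b; apply/asboolP/(valP q). Qed.

Definition Mats_of b d (q : Mat d b) : Mats t n :=
  exist (fun q => is_true `[< exists d b : Lambda t n, Mat_pred d b q >])
    _ (Mats_of_subproof q).

Lemma Mats_MatK (q : Mats t n) : Mats_of (Mats_Mat q) = q.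
Proof. exact: val_inj. Qed.

Lemma Mats_of_sums b d (q : Mat d b) :
  (b, d) = (col_sums (Mats_of q), row_sums (Mats_of q)).
Proof.
have /asboolP[_ _ _ qb qd] := valP q.
by congr pair; apply/esym/val_inj/funext.
Qed.

Definition coef (q : Mats t n) (x : Salg t n) : k^o :=
  (dsum_fun x (col_sums q, row_sums q) : perm_hom k _ _) (base_pt (Mats_Mat q)).

Lemma coefE b d (q : Mat d b) (x : Salg t n) :
  coef (Mats_of q) x = (dsum_fun x (b, d) : perm_hom k _ _) (base_pt q).
Proof.
rewrite /coef; have : sval (Mats_Mat (Mats_of q)) = sval q by [].
(* The type of the matrix depends on its sums, so these are generalized before the equality of index
   pairs is substituted. *)
move: (Mats_Mat _); have := Mats_of_sums q.
move: (col_sums _) (row_sums _) => b' d' [<- <-] q' qq'.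
by rewrite (_ : q' = q) //; apply: val_inj.
Qed.

(** Within one summand this is the duality of [xi] and [base_pt]. In different summands both sides
    vanish, since a matrix determines its row and column sums. *)
Lemma dinj_base_pt (bd bd' : Lambda t n * Lambda t n)
    (q : Mat bd.2 bd.1) (q' : Mat bd'.2 bd'.1) :
  (dinj_fun (V := fun bd => Xhom bd.1 bd.2) (xi q') bd : perm_hom k _ _) (base_pt q)
    = (Mats_of q' == Mats_of q)%:R.
Proof.
rewrite /dinj_fun; case: eqVneq => [e|ne].
  by case: bd / e q => q; rewrite (xi_base_pt hk hn).
case: eqVneq => // qq'; case/eqP: ne.
have := Mats_of_sums q; have := Mats_of_sums q'; rewrite qq' => <-.
by rewrite -!surjective_pairing.
Qed.

Lemma xiS_basis : is_basis (fun q : Mats t n => xiS q : Salg t n).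
Proof.
apply: (@dual_is_basis _ _ _ _ coef).
- by [].
- move=> q q'; rewrite -{2}(Mats_MatK q) -{2}(Mats_MatK q').
  exact: (@dinj_base_pt (_, _) (_, _)).
- move=> x; have /asboolP finx := valP x.
  (* A nonzero coefficient lies over one of the finitely many nonzero components of [x], and each
     component carries finitely many matrices. *)
  apply: (@sub_finite_set _ _ (\bigcup_(bd in [set bd | dsum_fun x bd != 0])
      (range (fun q : Mat bd.2 bd.1 => Mats_of q)))).
    move=> q qx; exists (col_sums q, row_sums q); last first.
      by exists (Mats_Mat q); rewrite ?Mats_MatK.
    by apply: contraNneq qx; rewrite /coef => ->.
  apply: bigcup_finite => // bd _; apply: finite_image.
  exact: (finite_Mat hk hn bd.1 bd.2).
- move=> x x0; apply/val_inj/functional_extensionality_dep => -[b d].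
  by apply: eq0_base_pt => q; rewrite -coefE x0.
Qed.

End main.

Theorem proposition4p4p2 (k : fieldType) (hk : [pchar k] =i pred0) (t : k)
    (n : option nat) (hn : n != Some 0%N) :
  (forall b d : Lambda t n,
     is_basis (fun q : Mat d b => xi q : Mor (Perm t) (Xperm b) (Xperm d)) /\
     finite_dimensional (Mor (Perm t) (Xperm b) (Xperm d))) /\
  is_basis (fun q : Mats t n => xiS q : Salg t n).
Proof.
split=> [b d|]; last exact: xiS_basis.
split; first exact: xi_basis.
by apply: finite_basis_dim (xi_basis hk hn b d); apply: (finite_Mat hk hn).
Qed.
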